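(* Let $n\in\{2,3\}$, let $\Omega$ be $\mathbb{R}^n$, the torus $\mathbb{T}^n$, or a bounded domain in $\mathbb{R}^n$ with smooth boundary, and let $\mu>0$. Let $(v,F)$ (with a pressure $p$) be a smooth solution on $[0,T)\times\Omega$ of $$\nabla\cdot v=0,\qquad v_t+v\cdot\nabla v+\nabla p=\mu\Delta v+\nabla\cdot\Big[\frac{\partial W(F)}{\partial F}F^T\Big],\qquad F_t+v\cdot\nabla F=\nabla v\,F,$$ with initial data $v(0,x)=v_0(x)$, $F(0,x)=I+E_0(x)$, and, when $\Omega$ is a bounded domain, with the boundary conditions $v=0$, $F-I=0$ on $[0,T)\times\partial\Omega$. Put $E=F-I$. Assume that $$\nabla_mE_{0ij}-\nabla_jE_{0im}=E_{0lj}\nabla_lE_{0im}-E_{0lm}\nabla_lE_{0ij}\quad\text{in }\Omega\text{ for all } i,j,m\in\{1,\dots,n\}.$$ Then $$\nabla_mE_{ij}-\nabla_jE_{im}=E_{lj}\nabla_lE_{im}-E_{lm}\nabla_lE_{ij}\quad\text{for all } i,j,m\in\{1,\dots,n\}$$ holds in $\Omega$ for all times $t\in[0,T)$.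
   Context: Notation: $v(t,x)\in\mathbb{R}^n$ is the velocity, $p$ the scalar pressure, $F(t,x)\in\mathbb{R}^{n\times n}$ the deformation tensor, $W$ a smooth elastic energy function of $F$, $I$ the identity matrix. $\nabla_j=\partial_j=\partial/\partial x_j$; repeated indices (here $l$) are summed. $(\nabla v)_{ij}=\partial v_i/\partial x_j$, $(\nabla v\,F)_{ij}=(\nabla v)_{ik}F_{kj}$, $(\nabla\cdot F)_i=\partial_jF_{ij}$; $\frac{\partial W(F)}{\partial F}$ is the matrix with entries $\partial W/\partial F_{ij}$. ''Smooth solution'' means that $v$ and $F$ have continuous derivatives of all orders occurring (at least $C^2$ in $(t,x)$, up to the boundary if $\Omega$ is bounded), with $v$ and $\nabla v$ bounded on $[0,T']\times\Omega$ for every $T'<T$. *)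

(* Defs.v *)
From mathcomp Require Import all_boot all_order all_algebra.
From mathcomp Require Import all_classical all_reals all_analysis.
Set Implicit Arguments.
Unset Strict Implicit.
Unset Printing Implicit Defensive.
Import Order.TTheory GRing.Theory Num.Theory.
Import numFieldNormedType.Exports.
Local Open Scope classical_set_scope.
Local Open Scope ring_scope.

(** * Functions of class C^k up to the boundary *)

(* For A open: f is C^k on A and all its derivatives of order at most k extend
   continuously to B.  Derivatives are iterated directional derivatives; as they
   are all required to be continuous, directional and partial derivatives give
   the same class. *)
Fixpoint Ck_extends (R : realType) (V : normedModType R) (k : nat)
    (A B : set V) (f : V -> R) : Prop :=
  (exists2 g : V -> R, {within B, continuous g} & forall z, A z -> f z = g z) /\
  match k with
  | 0 => True
  | k'.+1 => forall u : V,
      (forall z, A z -> derivable f z u) /\ Ck_extends k' A B (fun z => 'D_u f z)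
  end.

(* The first clause makes f itself, and not only a continuous extension of its
   restriction to A, continuous on B. *)
Definition Ck_upto (R : realType) (V : normedModType R) (k : nat)
    (A B : set V) (f : V -> R) : Prop :=
  {within B, continuous f} /\ Ck_extends k A B f.

Definition smooth (R : realType) (V : normedModType R) (f : V -> R) : Prop :=
  forall k, Ck_upto k setT setT f.

(** * Spatial domains *)

Definition boundary (R : realType) (n : nat) (A : set 'rV[R]_n) : set 'rV[R]_n :=
  closure A `\` A°.

(* Near each boundary point, A is the sublevel set of a smooth function with
   nonzero differential at that point. *)
Definition smooth_boundary (R : realType) (n : nat) (A : set 'rV[R]_n) : Prop :=
  forall x0, boundary A x0 ->
  exists phi : 'rV[R]_n -> R,
    [/\ smooth phi,
        exists u, 'D_u phi x0 != 0
      & \forall x \near x0, A x <-> phi x < 0].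

Definition bounded_smooth_domain (R : realType) (n : nat)
    (A : set 'rV[R]_n) : Prop :=
  [/\ A !=set0, open A, connected A, bounded_set A & smooth_boundary A].

(* Functions on the torus R^n / Z^n are the Z^n-periodic functions on R^n. *)
Variant domain (R : realType) (n : nat) :=
  | WholeSpace
  | Torus
  | BoundedDomain of set 'rV[R]_n.

Arguments WholeSpace {R n}.
Arguments Torus {R n}.

Definition region (R : realType) (n : nat) (D : domain R n) : set 'rV[R]_n :=
  match D with
  | WholeSpace | Torus => setT
  | BoundedDomain A => A
  end.

Definition admissible (R : realType) (n : nat) (D : domain R n) : Prop :=
  match D with
  | WholeSpace | Torus => True
  | BoundedDomain A => bounded_smooth_domain A
  end.

Definition periodic (R : realType) (n : nat) (X : Type)
    (f : 'rV[R]_n -> X) : Prop :=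
  forall (k : 'I_n) (x : 'rV[R]_n), f (x + delta_mx 0 k) = f x.

Definition function_on (R : realType) (n : nat) (X : Type) (D : domain R n)
    (f : 'rV[R]_n -> X) : Prop :=
  match D with
  | Torus => periodic f
  | WholeSpace | BoundedDomain _ => True
  end.

(** * Differential operators *)

Definition partial (R : realType) (n : nat) (k : 'I_n)
    (f : 'rV[R]_n -> R) (x : 'rV[R]_n) : R :=
  'D_(delta_mx 0 k) f x.

Definition dt (R : realType) (n : nat) (f : R -> 'rV[R]_n -> R)
    (t : R) (x : 'rV[R]_n) : R :=
  derive1 (fun s => f s x) t.

Definition laplacian (R : realType) (n : nat)
    (f : 'rV[R]_n -> R) (x : 'rV[R]_n) : R :=
  \sum_(k < n) partial k (partial k f) x.

Definition grad_vec (R : realType) (n : nat)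
    (u : 'rV[R]_n -> 'rV[R]_n) (x : 'rV[R]_n) : 'M[R]_n :=
  \matrix_(i, j) partial j (fun y => u y 0 i) x.

Definition div_vec (R : realType) (n : nat)
    (u : 'rV[R]_n -> 'rV[R]_n) (x : 'rV[R]_n) : R :=
  \sum_(k < n) partial k (fun y => u y 0 k) x.

(* The i-th component of the divergence of a matrix field, taken along rows. *)
Definition div_mx (R : realType) (n : nat)
    (G : 'rV[R]_n -> 'M[R]_n) (i : 'I_n) (x : 'rV[R]_n) : R :=
  \sum_(j < n) partial j (fun y => G y i j) x.

Definition advect (R : realType) (n : nat) (u : 'rV[R]_n -> 'rV[R]_n)
    (f : 'rV[R]_n -> R) (x : 'rV[R]_n) : R :=
  \sum_(k < n) u x 0 k * partial k f x.

Definition dW (R : realType) (n : nat) (W : 'M[R]_n -> R) (A : 'M[R]_n) : 'M[R]_n :=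
  \matrix_(i, j) 'D_(delta_mx i j) W A.

(** * The viscoelastic system *)

(* T may be +oo. *)
Definition spacetime (R : realType) (n : nat) (T : \bar R) (A : set 'rV[R]_n) :
    set (R * 'rV[R]_n)%type :=
  [set z | [/\ 0 <= z.1, (z.1%:E < T)%E & A z.2]].

Definition spacetime_interior (R : realType) (n : nat) (T : \bar R)
    (A : set 'rV[R]_n) : set (R * 'rV[R]_n)%type :=
  [set z | [/\ 0 < z.1, (z.1%:E < T)%E & A z.2]].

Definition C2_field (R : realType) (n : nat) (T : \bar R) (A : set 'rV[R]_n)
    (f : R -> 'rV[R]_n -> R) : Prop :=
  Ck_upto 2 (spacetime_interior T A) (spacetime T (closure A))
    (fun z : R * 'rV[R]_n => f z.1 z.2).

(* The two evolution equations are imposed for 0 < t < T, where the two-sided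
   time derivative makes sense; since all derivatives of v and F extend
   continuously to t = 0, this is the same as imposing them on [0, T) with the
   one-sided time derivative at t = 0. *)
Record smooth_solution (R : realType) (n : nat) (mu : R) (W : 'M[R]_n -> R)
    (D : domain R n) (T : \bar R) (v : R -> 'rV[R]_n -> 'rV[R]_n)
    (F : R -> 'rV[R]_n -> 'M[R]_n) (p : R -> 'rV[R]_n -> R) : Prop :=
  SmoothSolution {
    sol_on_domain : forall t, 0 <= t -> (t%:E < T)%E ->
      [/\ function_on D (v t), function_on D (F t) & function_on D (p t)];
    sol_v_C2 : forall i, C2_field T (region D) (fun t x => v t x 0 i);
    sol_F_C2 : forall i j, C2_field T (region D) (fun t x => F t x i j);
    sol_p_derivable : forall t x k, 0 < t -> (t%:E < T)%E -> region D x ->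
      derivable (p t) x (delta_mx 0 k);
    sol_bounded : forall T' : R, (T'%:E < T)%E ->
      exists M : R, forall t x, 0 <= t <= T' -> region D x ->
        `|v t x| <= M /\ `|grad_vec (v t) x| <= M;
    sol_div_free : forall t x, 0 <= t -> (t%:E < T)%E -> region D x ->
      div_vec (v t) x = 0;
    sol_momentum : forall t x i, 0 < t -> (t%:E < T)%E -> region D x ->
      dt (fun s y => v s y 0 i) t x + advect (v t) (fun y => v t y 0 i) x
        + partial i (p t) x
      = mu * laplacian (fun y => v t y 0 i) x
        + div_mx (fun y => dW W (F t y) *m (F t y)^T) i x;
    sol_transport : forall t x i j, 0 < t -> (t%:E < T)%E -> region D x ->
      dt (fun s y => F s y i j) t x + advect (v t) (fun y => F t y i j) x
      = (grad_vec (v t) x *m F t x) i j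
  }.

Definition boundary_conditions (R : realType) (n : nat) (D : domain R n)
    (T : \bar R) (v : R -> 'rV[R]_n -> 'rV[R]_n)
    (F : R -> 'rV[R]_n -> 'M[R]_n) : Prop :=
  match D with
  | WholeSpace | Torus => True
  | BoundedDomain A => forall t x, 0 <= t -> (t%:E < T)%E -> boundary A x ->
      v t x = 0 /\ F t x - 1%:M = 0
  end.

(* Main.v *)
Require Import Defs.
From mathcomp Require Import all_boot all_order all_algebra.
From mathcomp Require Import all_classical all_reals all_analysis.
From mathcomp Require Import ring lra.
Import Order.TTheory GRing.Theory Num.Theory.
Import numFieldNormedType.Exports.
Local Open Scope classical_set_scope.
Local Open Scope ring_scope.

(** Read the columns [f_1, ..., f_n] of [F] as vector fields on space.  The
    equation for [F] says that each [f_j] commutes with the material derivative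
    [D_t = d/dt + v . grad], and, since [F = 1 + E], the compatibility condition
    on [E] says that the brackets
      [H i j m = sum_l (F l m * d_l F i j - F l j * d_l F i m)],
    the components of [[f_m, f_j]], all vanish.  By the Jacobi identity the
    brackets commute with [D_t] too, that is
      [D_t (H i j m) = sum_k d_k v_i * H k j m]
    ([derive_bracket]): a linear system without source along the trajectories
    of [v].  It remains to see that zero initial data propagate.

    This is done without constructing trajectories.  The function [phi], the sum
    of the squares of all [H i j m], satisfies [D_t phi <= C * phi], where [C]
    comes from the bound on [grad v].  Consider the maximum of
    [exp (- (C + 1) t) * phi] over the compact backward cone
    [|x - x0| <= M * (t0 - t)], where [M] bounds [|v|].  If this maximum were
    positive, a short step backwards in time in the direction [(1, v)], taken
    from a maximum point, would stay in the cone and increase the function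
    ([transport_max_principle]).  The cone replaces any control of [phi] at
    spatial infinity, so that one argument serves all three kinds of domain.

    The delicate points are the lateral boundary of a bounded domain and the time
    [t = 0], where only continuous extensions of the derivatives are available.
    Both are settled by [increment_closure], a mean value estimate along segments
    that are limits of interior segments.  At a boundary point [v] vanishes, so
    that the backward step moves in time only and is such a limit; at [t = 0] the
    estimate identifies the spatial derivatives of the initial data with the
    extensions of the interior ones ([initial_derive]). *)

(** * Directional derivatives *)

Section Calculus.
Context {R : realType} {V : normedModType R}.
Implicit Types (A B S : set V) (f g : V -> R) (a u w z : V) (e c h : R).

Lemma within_continuous_norm B f z e : {within B, continuous f} -> B z -> 0 < e ->
  exists2 d, 0 < d & forall y, B y -> `|y - z| < d -> `|f y - f z| < e.
Proof.
move=> /subspace_continuousP cf Bz e0.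
have /cvgrPdist_lt /(_ e e0) := cf z Bz.
rewrite /prop_near1 /within /= => /nbhs_normP [d /= d0 H].
exists d => // y By yz; rewrite distrC; apply: H => //=.
by rewrite distrC.
Qed.

Lemma closure_norm S z e : closure S z -> 0 < e ->
  exists2 y, S y & `|y - z| < e.
Proof.
move=> cS e0; have [y [Sy /=]] := cS _ (nbhsx_ballx z e e0).
by rewrite -ball_normE /= => yz; exists y => //; rewrite distrC.
Qed.

Lemma norm_closure S z :
  (forall e, 0 < e -> exists2 y, S y & `|y - z| < e) -> closure S z.
Proof.
move=> H U /nbhs_normP[e /= e0 eU]; have [y Sy yz] := H e e0.
by exists y; split => //; apply: eU; rewrite /= distrC.
Qed.

Lemma open_norm A z : open A -> A z ->
  exists2 e : R, 0 < e & forall y, `|y - z| < e -> A y.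
Proof.
move=> oA Az; have /nbhs_normP[e /= e0 eA] := open_nbhs_nbhs (conj oA Az).
by exists e => // y yz; apply: eA; rewrite /= distrC.
Qed.

Lemma is_derive_line f a u (s : R) : derivable f (a + s *: u) u ->
  is_derive s 1 (fun r => f (a + r *: u)) ('D_u f (a + s *: u)).
Proof.
move=> df.
have E : (fun h : R => h^-1 *: (f (a + (h *: 1 + s) *: u) - f (a + s *: u)))
       = (fun h => h^-1 *: (f (h *: u + (a + s *: u)) - f (a + s *: u))).
  apply/funext => h; congr (_ *: (f _ - _)).
  by rewrite scalerDl addrCA /GRing.scale /= mulr1.
apply: DeriveDef; first by rewrite /derivable E.
by rewrite /derive E.
Qed.

Lemma directional_mean_value f a u h : 0 <= h ->
  (forall s, 0 <= s <= h -> derivable f (a + s *: u) u) ->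
  exists2 s, 0 <= s <= h & f (a + h *: u) - f a = h * 'D_u f (a + s *: u).
Proof.
move=> h0 df.
have [||s] := @MVT_segment R (fun r => f (a + r *: u))
    (fun s => 'D_u f (a + s *: u)) 0 h h0.
- by move=> s; rewrite in_itv/= => /andP[s0 sh]; apply/is_derive_line/df; rewrite !ltW.
- apply: (@derivable_within_continuous _ _ _ `[0, h]) => s.
  rewrite in_itv/= => sh.
  by have [] := @is_derive_line f a u s (df s sh).
- rewrite in_itv/= => sh; rewrite scale0r addr0 subr0 mulrC => E.
  by exists s.
Qed.

(** The segment from [a] to [a + h *: u] may lie on the boundary of [A], where [f]
    need not have a derivative: the estimate along it is the limit of the mean
    value estimates along parallel segments inside [A]. *)
Lemma increment_closure A B f g a u h c e : A `<=` B ->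
  {within B, continuous g} -> (forall z, A z -> f z = g z) ->
  (forall z, A z -> derivable f z u) ->
  0 <= h -> B a -> B (a + h *: u) ->
  closure [set z | forall s, 0 <= s <= h ->
             A (z + s *: u) /\ `|'D_u f (z + s *: u) - c| <= e] a ->
  `|g (a + h *: u) - g a - h * c| <= h * e.
Proof.
move=> AB cg fg df h0 Ba Bah clS.
apply/ler_addgt0Pr => r r0.
have r20 : 0 < r / 2 by rewrite divr_gt0.
have [d1 d10 H1] := @within_continuous_norm _ _ _ _ cg Ba r20.
have [d2 d20 H2] := @within_continuous_norm _ _ _ _ cg Bah r20.
have d0 : 0 < Num.min d1 d2 by rewrite lt_min d10.
have [z /= Sz] := @closure_norm _ _ _ clS d0.
rewrite lt_min => /andP[zd1 zd2].
have Az s : 0 <= s <= h -> A (z + s *: u) by move=> /Sz[].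
have [|s sh E] := @directional_mean_value f z u h h0.
  by move=> s /Az; exact: df.
have A0 : A z by have := Az 0; rewrite scale0r addr0; apply; rewrite lexx.
have Ah : A (z + h *: u) by apply: Az; rewrite lexx h0.
have {H1} := H1 _ (AB _ A0) zd1.
have {H2} := H2 _ (AB _ Ah).
have -> : z + h *: u - (a + h *: u) = z - a by rewrite opprD addrACA subrr addr0.
move=> /(_ zd2).
rewrite -(fg _ A0) -(fg _ (Az _ _)) ?lexx ?h0//.
have [_ H3] := Sz s sh.
have H4 : `|f (z + h *: u) - f z - h * c| <= h * e.
  by rewrite E -mulrBr normrM ger0_norm// ler_wpM2l.
move: H4; set p := f (z + h *: u); set q := f z; set b := g _; set k := g _.
rewrite !ltr_norml !ler_norml => /andP[? ?] /andP[? ?] /andP[? ?].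
by apply/andP; split; lra.
Qed.

Lemma derivable_approx f z u e : derivable f z u -> 0 < e ->
  exists2 d, 0 < d & forall h, `|h| < d ->
    `|f (z + h *: u) - f z - h * 'D_u f z| <= `|h| * e.
Proof.
move=> df e0.
have : (fun h => h^-1 *: (f (h *: u + z) - f z)) @ (0 : R)^' --> 'D_u f z.
  exact: df.
move=> /cvgrPdist_lt /(_ e e0); rewrite /prop_near1 /dnbhs /within /=.
move=> /nbhs_normP [d /= d0 H]; exists d => // h hd.
have [->|hn0] := eqVneq h 0.
  by rewrite scale0r addr0 subrr mul0r subrr normr0 mul0r.
have /= := H h _ hn0; rewrite sub0r normrN => /(_ hd).
rewrite distrC /GRing.scale /= => /ltW H1.
have -> : f (z + h *: u) - f z - h * 'D_u f z =
          h * (h^-1 * (f (h *: u + z) - f z) - 'D_u f z).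
  by rewrite mulrBr mulrA divff// mul1r [z + _]addrC.
by rewrite normrM ler_wpM2l.
Qed.

Lemma derive_from_approx f z u c :
  (forall e, 0 < e -> exists2 d, 0 < d & forall h, 0 < `|h| < d ->
    `|f (z + h *: u) - f z - h * c| <= `|h| * e) ->
  derivable f z u /\ 'D_u f z = c.
Proof.
move=> H.
have C : (fun h => h^-1 *: (f (h *: u + z) - f z)) @ (0 : R)^' --> c.
  apply/cvgrPdist_le => e e0; have [d d0 K] := H e e0.
  rewrite /prop_near1 /dnbhs /within /=.
  apply/nbhs_normP; exists d => // h; rewrite /= ?sub0r ?normrN => hd hn0.
  have /K K1 : 0 < `|h| < d by rewrite normr_gt0 hn0.
  rewrite distrC /GRing.scale /=; move: K1.
  have -> : f (z + h *: u) - f z - h * c =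
          h * (h^-1 * (f (h *: u + z) - f z) - c).
    by rewrite mulrBr mulrA divff// mul1r [z + _]addrC.
  by rewrite normrM ler_pM2l// normr_gt0.
split; first by apply/cvg_ex; exists c.
exact/cvg_lim.
Qed.

(** Increments with [h > 0] suffice, because the derivative is known to exist. *)
Lemma derive_uniq f z u c : derivable f z u ->
  (forall e, 0 < e -> exists2 d, 0 < d & forall h, 0 < h < d ->
    `|f (z + h *: u) - f z - h * c| <= h * e) ->
  'D_u f z = c.
Proof.
move=> df H; apply/eqP; rewrite -subr_eq0 -normr_le0.
apply/ler_addgt0Pr => e e0; rewrite add0r.
have e20 : 0 < e / 2 by rewrite divr_gt0.
have [d1 d10 H1] := @derivable_approx f z u _ df e20.
have [d2 d20 H2] := H _ e20.
set h := Num.min d1 d2 / 2.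
have m0 : 0 < Num.min d1 d2 by rewrite lt_min d10.
have h0 : 0 < h by rewrite divr_gt0.
have hm : h < Num.min d1 d2 by rewrite ltr_pdivrMr// ltr_pMr// ltr1n.
move: hm; rewrite lt_min => /andP[hd1 hd2].
have {H1} := H1 h; rewrite gtr0_norm// => /(_ hd1) H1.
have {H2} := H2 h; rewrite h0 hd2 => /(_ erefl) H2.
rewrite -(ler_pM2l h0) -[X in X * `|_|]gtr0_norm// -normrM.
move: H1 H2; rewrite mulrBr !ler_norml => /andP[? ?] /andP[? ?].
by apply/andP; split; lra.
Qed.

Lemma deriveZdir f z u c : derivable f z u ->
  derivable f z (c *: u) /\ 'D_(c *: u) f z = c * 'D_u f z.
Proof.
move=> df; apply: derive_from_approx => e e0.
have k0 : 0 < `|c| + 1 by rewrite ltr_wpDl.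
have ek : 0 < e / (`|c| + 1) by rewrite divr_gt0.
have [d d0 H] := @derivable_approx f z u _ df ek.
exists (d / (`|c| + 1)); first by rewrite divr_gt0.
move=> h /andP[h0]; rewrite ltr_pdivlMr// => hd.
have {H} := H (h * c); rewrite scalerA normrM mulrA => H.
apply: le_trans (H _) _.
  by apply: le_lt_trans hd; rewrite ler_wpM2l// lerDl.
rewrite -mulrA ler_wpM2l// mulrA ler_pdivrMr// mulrC ler_wpM2l//; first exact: ltW.
by rewrite lerDl.
Qed.

(** For an open [A] in finite dimension this is the class C^1, as [u] ranges over
    all directions. *)
Definition C1_on A f := forall u z, A z ->
  derivable f z u /\ {for z, continuous (fun y => 'D_u f y)}.

Lemma for_continuous_norm f z e : {for z, continuous f} -> 0 < e ->
  exists2 d, 0 < d & forall y, `|y - z| < d -> `|f y - f z| < e.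
Proof.
move=> /cvgrPdist_lt /[apply]; rewrite /prop_near1 => /nbhs_normP[d /= d0 H].
by exists d => // y yz; rewrite distrC; apply: H; rewrite /= distrC.
Qed.

(** Additivity in the direction: travel along [h *: u], then along [h *: w]; the
    second increment is [h] times a value of ['D_w f] near [z], hence close to
    [h * 'D_w f z] by continuity of ['D_w f]. *)
Lemma deriveDdir A f z u w : open A -> C1_on A f -> A z ->
  'D_(u + w) f z = 'D_u f z + 'D_w f z.
Proof.
move=> oA cf Az; apply: derive_uniq => [|e e0]; first exact: (cf _ _ Az).1.
have e20 : 0 < e / 2 by rewrite divr_gt0.
have [d1 d10 H1] := @derivable_approx f z u _ (cf u z Az).1 e20.
have [d2 d20 H2] := @for_continuous_norm _ z _ (cf w z Az).2 e20.
have [d3 d30 H3] := @open_norm _ _ oA Az.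
pose d := Num.min d1 (Num.min d2 d3 / (`|u| + `|w| + 1)).
have k0 : 0 < `|u| + `|w| + 1 by rewrite ltr_wpDl// addr_ge0.
exists d; first by rewrite !lt_min d10 divr_gt0// lt_min d20.
move=> h /andP[h0]; rewrite lt_min => /andP[hd1].
rewrite ltr_pdivlMr// lt_min => /andP[hd2 hd3].
have B s : 0 <= s <= h -> `|z + h *: u + s *: w - z| <= h * (`|u| + `|w| + 1).
  move=> /andP[s0 sh]; rewrite addrC addrA addKr.
  rewrite (le_trans (ler_normD _ _))// !normrZ (ger0_norm s0) gtr0_norm//.
  by rewrite mulrDr mulrDr mulr1 ler_wpDr ?lerD ?ler_wpM2r// ?ltW.
have [|s sh E] := @directional_mean_value f (z + h *: u) w h (ltW h0).
  move=> s /B sB; apply: (cf _ _ _).1; apply: H3; exact: le_lt_trans sB hd3.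
have K2 := H2 _ (le_lt_trans (B s sh) hd2).
have K1 : `|f (z + h *: u) - f z - h * 'D_u f z| <= h * (e / 2).
  by have := H1 h; rewrite gtr0_norm//; apply.
have K3 : `|f (z + h *: u + h *: w) - f (z + h *: u) - h * 'D_w f z| <= h * (e / 2).
  by rewrite E -mulrBr normrM gtr0_norm// ler_pM2l// ltW.
rewrite scalerDr addrA.
move: K1 K3; rewrite !ler_norml => /andP[? ?] /andP[? ?].
by apply/andP; split; lra.
Qed.

Lemma derive_sumdir A f z (n : nat) (u : 'I_n -> V) : open A -> C1_on A f -> A z ->
  'D_(\sum_(k < n) u k) f z = \sum_(k < n) 'D_(u k) f z.
Proof.
move=> oA cf Az.
pose P (x : V) (y : R) := 'D_x f z = y.
apply: (big_ind2 P); rewrite /P //; first exact: derive0.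
by move=> x1 x2 y1 y2 <- <-; apply: (@deriveDdir A).
Qed.

Lemma derive_linear_comb A f z (n : nat) (u0 : V) (c : 'I_n -> R) (u : 'I_n -> V) :
  open A -> C1_on A f -> A z ->
  'D_(u0 + \sum_(k < n) c k *: u k) f z
  = 'D_u0 f z + \sum_(k < n) c k * 'D_(u k) f z.
Proof.
move=> oA cf Az; rewrite (deriveDdir A)//; congr (_ + _).
rewrite (derive_sumdir A)//; apply: eq_bigr => k _.
exact: (deriveZdir _ _ _ _ (cf _ _ Az).1).2.
Qed.

(** Two mean value steps: one for the increment [f (y + h *: w) - f y] in the
    direction [u], then one for ['D_u f] in the direction [w]. *)
Lemma second_difference A f z u w h d : C1_on A f -> C1_on A ('D_u f) ->
  (forall y, `|y - z| <= h * (`|u| + `|w|) -> A y) -> 0 < h ->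
  d = (f (z + h *: u + h *: w) - f (z + h *: u)) - (f (z + h *: w) - f z) ->
  exists2 y, `|y - z| <= h * (`|u| + `|w|) & d = h * h * 'D_w ('D_u f) y.
Proof.
move=> cf cuf HA h0 ->.
have B s t : 0 <= s <= h -> 0 <= t <= h ->
    `|z + s *: u + t *: w - z| <= h * (`|u| + `|w|).
  move=> /andP[s0 sh] /andP[t0 th]; rewrite addrC addrA addKr.
  rewrite (le_trans (ler_normD _ _))// !normrZ (ger0_norm s0) (ger0_norm t0).
  by rewrite mulrDr lerD ?ler_wpM2r.
have h0' : (0 : R) <= 0 <= h by rewrite lexx ltW.
pose g y := f (y + h *: w) - f y.
have gd s : 0 <= s <= h -> derivable g (z + s *: u) u /\ 'D_u g (z + s *: u) =
    'D_u f (z + s *: u + h *: w) - 'D_u f (z + s *: u).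
  move=> sh.
  have A1 : A (z + s *: u + h *: w) by apply: HA; apply: B; rewrite // lexx ltW.
  have A2 : A (z + s *: u) by have := B s 0 sh h0'; rewrite scale0r addr0 => /HA.
  have [D1 _] := cf u _ A1; have [D2 _] := cf u _ A2.
  have E : (fun r : R => r^-1 *: (f (r *: u + (z + s *: u) + h *: w)
                - f (z + s *: u + h *: w)))
           = (fun r => r^-1 *: (f (r *: u + (z + s *: u + h *: w))
                - f (z + s *: u + h *: w))).
    by apply/funext => r; rewrite -[r *: u + (_ + _) + _]addrA.
  have D3 : is_derive (z + s *: u) u (fun y => f (y + h *: w))
      ('D_u f (z + s *: u + h *: w)).
    by apply: DeriveDef; [rewrite /derivable E | rewrite /derive E].
  have := @is_deriveB _ _ _ _ _ _ _ _ _ D3 (derivableP D2).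
  by case.
have [|s sh E] := @directional_mean_value g z u h (ltW h0).
  by move=> s /gd[].
have [|t th E2] := @directional_mean_value ('D_u f) (z + s *: u) w h (ltW h0).
  by move=> t th; apply: (cuf _ _ _).1; apply/HA/B.
exists (z + s *: u + t *: w); first exact: B.
by move: E; rewrite (gd s sh).2 E2 mulrA /g.
Qed.

Lemma norm_sub_halves (p p' q r e : R) : p = p' ->
  `|p - q| < e / 2 -> `|p' - r| < e / 2 -> `|q - r| <= e.
Proof.
move=> <-; rewrite !ltr_norml ler_norml => /andP[? ?] /andP[? ?].
by apply/andP; split; lra.
Qed.

(** Schwarz's theorem: the second difference is symmetric in [u] and [w], so
    [second_difference] writes it both as a value of ['D_w ('D_u f)] and as one of
    ['D_u ('D_w f)] at points close to [z]. *)
Lemma derive_derive_comm A f z u w : open A -> C1_on A f -> C1_on A ('D_u f) ->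
  C1_on A ('D_w f) -> A z -> 'D_w ('D_u f) z = 'D_u ('D_w f) z.
Proof.
move=> oA cf cu cw Az; apply/eqP; rewrite -subr_eq0 -normr_le0.
apply/ler_addgt0Pr => e e0; rewrite add0r.
have e20 : 0 < e / 2 by rewrite divr_gt0.
have [d1 d10 H1] := @for_continuous_norm _ z _ (cu w z Az).2 e20.
have [d2 d20 H2] := @for_continuous_norm _ z _ (cw u z Az).2 e20.
have [d3 d30 H3] := @open_norm _ _ oA Az.
pose m := Num.min d1 (Num.min d2 d3).
have m0 : 0 < m by rewrite !lt_min d10 d20.
have k0 : 0 < `|u| + `|w| + 1 by rewrite ltr_wpDl// addr_ge0.
pose h := m / (`|u| + `|w| + 1).
have h0 : 0 < h by rewrite divr_gt0.
have hm : h * (`|u| + `|w|) < m.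
  by rewrite /h mulrAC ltr_pdivrMr// ltr_pM2l// ltrDl.
have [hm1 [hm2 hm3]] : h * (`|u| + `|w|) < d1 /\
    h * (`|u| + `|w|) < d2 /\ h * (`|u| + `|w|) < d3.
  by move: hm; rewrite !lt_min => /andP[? /andP[]].
have HA y : `|y - z| <= h * (`|u| + `|w|) -> A y.
  by move=> yz; apply: H3; apply: le_lt_trans yz hm3.
have [y1 y1z E1] := @second_difference A f z u w h _ cf cu HA h0 erefl.
have [|y2 y2z E2] := @second_difference A f z w u h _ cf cw _ h0 erefl.
  by move=> y; rewrite [`|w| + _]addrC; exact: HA.
have K1 := H1 _ (le_lt_trans y1z hm1).
have K2 : `|'D_u ('D_w f) y2 - 'D_u ('D_w f) z| < e / 2.
  by apply: H2; apply: le_lt_trans hm2; rewrite [`|u| + _]addrC.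
have swap (p p' q r s : R) : p = p' -> p - q - (r - s) = p' - r - (q - s).
  by move=> ->; ring.
have hh0 : h * h != 0 by rewrite mulf_neq0// gt_eqF.
have E3 : 'D_w ('D_u f) y1 = 'D_u ('D_w f) y2.
  apply: (mulfI hh0); apply: etrans (esym E1) (etrans _ E2).
  by apply: swap; rewrite addrAC.
by apply: norm_sub_halves E3 K1 K2.
Qed.

End Calculus.

(** * Continuity and differentiability up to the boundary *)

Section Within.
Context {R : realType} {T : topologicalType}.
Implicit Types (B : set T) (f g : T -> R).

Lemma within_cst B (c : R) : {within B, continuous (fun _ : T => c)}.
Proof. by apply: continuous_subspaceT => x; apply: cst_continuous. Qed.

Lemma withinD B f g : {within B, continuous f} -> {within B, continuous g} ->
  {within B, continuous (fun z => f z + g z)}.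
Proof. by move=> cf cg x; apply: continuousD; [exact: cf|exact: cg]. Qed.

Lemma withinM B f g : {within B, continuous f} -> {within B, continuous g} ->
  {within B, continuous (fun z => f z * g z)}.
Proof. by move=> cf cg x; apply: continuousM; [exact: cf|exact: cg]. Qed.

Lemma withinB B f g : {within B, continuous f} -> {within B, continuous g} ->
  {within B, continuous (fun z => f z - g z)}.
Proof. by move=> cf cg x; apply: continuousB; [exact: cf|exact: cg]. Qed.

Lemma within_sum B n (f : 'I_n -> T -> R) :
  (forall i, {within B, continuous (f i)}) ->
  {within B, continuous (fun z => \sum_(i < n) f i z)}.
Proof.
move=> cf; rewrite -fct_sumE.
apply: (big_ind (fun g : T -> R => {within B, continuous g})) => //.
- exact: within_cst.
- by move=> g h; apply: withinD.
Qed.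
End Within.

Section Ck.
Context {R : realType} {V : normedModType R}.
Implicit Types (A B S : set V) (f g : V -> R) (a u w z : V) (e c h : R).

Lemma within_closure_le0 B S f z : {within B, continuous f} -> S `<=` B ->
  B z -> closure S z -> (forall y, S y -> f y <= 0) -> f z <= 0.
Proof.
move=> cf SB Bz cS f0; apply/ler_addgt0Pr => e e0; rewrite add0r.
have [d d0 H] := @within_continuous_norm _ _ _ _ _ _ cf Bz e0.
have [y Sy yz] := @closure_norm _ _ _ _ _ cS d0.
have := H y (SB _ Sy) yz; rewrite ltr_norml => /andP[+ _].
by have := f0 y Sy; lra.
Qed.

Lemma Ck_extendsW k A B f : Ck_extends k.+1 A B f -> Ck_extends k A B f.
Proof.
elim: k f => [|k IH] f; first by case.
move=> [ef df]; split=> // u; have [du eu] := df u.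
by split=> //; apply: IH.
Qed.

Lemma Ck_extends_C1_on A B f : open A -> A `<=` B -> Ck_extends 1 A B f -> C1_on A f.
Proof.
move=> oA AB [_ df] u z Az; have [du [[g cg fg] _]] := df u.
split; first exact: du.
apply/cvgrPdist_lt => e e0.
have [d d0 H] := @within_continuous_norm _ _ _ _ _ _ cg (AB _ Az) e0.
have [d' d'0 H'] := @open_norm _ _ _ _ oA Az.
apply/nbhs_normP; exists (Num.min d d'); first by rewrite /= lt_min d0.
move=> y /=; rewrite lt_min distrC => /andP[yd yd'].
by rewrite distrC fg ?(fg z)//; [apply: H => //; apply/AB/H'|apply: H'].
Qed.

Lemma Ck1_cst A B c : Ck_extends 1 A B (fun _ => c).
Proof.
split; first by exists (fun _ => c) => //; apply: within_cst.
move=> u; split=> [z Az|]; first exact: derivable_cst.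
split=> //; exists (fun _ => 0); first exact: within_cst.
by move=> z _; rewrite derive_cst.
Qed.

Lemma Ck1D A B f g : Ck_extends 1 A B f -> Ck_extends 1 A B g ->
  Ck_extends 1 A B (fun z => f z + g z).
Proof.
move=> [[f' cf ff'] df] [[g' cg gg'] dg]; split.
  exists (fun z => f' z + g' z); first exact: withinD.
  by move=> z Az; rewrite ff'// gg'.
move=> u; have [df0 [[f1 cf1 ff1] _]] := df u.
have [dg0 [[g1 cg1 gg1] _]] := dg u.
split=> [z Az|]; first exact: derivableD (df0 z Az) (dg0 z Az).
split=> //; exists (fun z => f1 z + g1 z); first exact: withinD.
by move=> z Az; rewrite -ff1// -gg1// -deriveD; [| exact: df0|exact: dg0].
Qed.

Lemma Ck1M A B f g : Ck_extends 1 A B f -> Ck_extends 1 A B g ->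
  Ck_extends 1 A B (fun z => f z * g z).
Proof.
move=> [[f' cf ff'] df] [[g' cg gg'] dg]; split.
  exists (fun z => f' z * g' z); first exact: withinM.
  by move=> z Az; rewrite ff'// gg'.
move=> u; have [df0 [[f1 cf1 ff1] _]] := df u.
have [dg0 [[g1 cg1 gg1] _]] := dg u.
split=> [z Az|]; first exact: derivableM (df0 z Az) (dg0 z Az).
split=> //; exists (fun z => f' z * g1 z + g' z * f1 z).
  by apply: withinD; apply: withinM.
move=> z Az; rewrite -ff1// -gg1// -ff'// -gg'//.
have := deriveM (df0 z Az) (dg0 z Az).
by rewrite /GRing.scale /= => <-.
Qed.

Lemma Ck1B A B f g : Ck_extends 1 A B f -> Ck_extends 1 A B g ->
  Ck_extends 1 A B (fun z => f z - g z).
Proof.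
move=> cf cg; have -> : (fun z => f z - g z) = (fun z => f z + (-1) * g z).
  by apply/funext => z; rewrite mulN1r.
by apply: Ck1D => //; apply: Ck1M => //; apply: Ck1_cst.
Qed.

Lemma Ck1_sum A B n (f : 'I_n -> V -> R) : (forall i, Ck_extends 1 A B (f i)) ->
  Ck_extends 1 A B (fun z => \sum_(i < n) f i z).
Proof.
move=> cf; rewrite -fct_sumE; apply: (big_ind (Ck_extends 1 A B)) => //.
- exact: Ck1_cst.
- by move=> g h; apply: Ck1D.
Qed.

End Ck.

(** * Space-time regions and backward cones *)

Section SpaceTime.
Context {R : realType} {n : nat}.
Implicit Types (A : set 'rV[R]_n) (T : \bar R).

Lemma norm_pair_lt (z : R * 'rV[R]_n) (e : R) :
  (`|z| < e) = (`|z.1| < e) && (`|z.2| < e).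
Proof. by rewrite prod_normE gt_max. Qed.

Lemma lte_fin_open (t : R) T : (t%:E < T)%E -> exists2 d, 0 < d &
  forall s, s < t + d -> (s%:E < T)%E.
Proof.
case: T => [r||] //; rewrite ?lte_fin.
  move=> tr; exists (r - t); first by rewrite subr_gt0.
  by move=> s; rewrite lte_fin addrCA subrr addr0.
by move=> _; exists 1 => // s _; rewrite ltry.
Qed.

Lemma open_spacetime_interior T A : open A -> open (spacetime_interior T A).
Proof.
move=> oA; rewrite openE => z [z0 zT Az].
apply/(@nbhs_normP _ (R * 'rV[R]_n)%type).
have [d d0 H] := @lte_fin_open _ _ zT.
have [e e0 He] := @open_norm _ _ _ _ oA Az.
exists (Num.min z.1 (Num.min d e)); first by rewrite /= !lt_min z0 d0.
move=> y /=; rewrite !lt_min distrC !norm_pair_lt /=.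
move=> /and3P[/andP[y1 _] /andP[y2 _] /andP[_ y3]].
move: y1 y2; rewrite !ltr_norml => /andP[? ?] /andP[? ?].
by split; [lra|apply: H; lra|exact: He].
Qed.

Lemma spacetime_interior_sub T A :
  spacetime_interior T A `<=` spacetime T (closure A).
Proof. by move=> z [z0 zT Az]; split; [exact: ltW| |exact: subset_closure]. Qed.

Definition edir (k : 'I_n) : R * 'rV[R]_n := (0, delta_mx 0 k).

Lemma sum_edir (w : 'rV[R]_n) : \sum_(k < n) w 0 k *: edir k = (0, w).
Proof.
rewrite [in RHS](row_sum_delta w).
apply: (big_ind2 (fun (p : R * 'rV[R]_n) x => p = (0, x))) => //.
  by move=> p x q y -> ->; congr pair; rewrite addr0.
by move=> k _; congr pair; rewrite scaler0.
Qed.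

End SpaceTime.

Section Cone.
Context {R : realType} {n : nat}.
Implicit Types (A : set 'rV[R]_n) (T : \bar R).

Definition backward_cone A (M t0 : R) (x0 : 'rV[R]_n) : set (R * 'rV[R]_n) :=
  [set z | [/\ 0 <= z.1, z.1 <= t0, closure A z.2 & `|z.2 - x0| <= M * (t0 - z.1)]].

Lemma closed_le_fun (V : topologicalType) (f g : V -> R) :
  continuous f -> continuous g -> closed [set z | f z <= g z].
Proof.
move=> cf cg; have -> : [set z | f z <= g z] = (fun z => f z - g z) @^-1` [set r | r <= 0].
  by apply/seteqP; split=> z /=; rewrite subr_le0.
apply: closed_comp; last exact: closed_le.
by move=> z _; apply: continuousB; [exact: cf|exact: cg].
Qed.

Lemma compact_backward_cone A M t0 x0 : 0 <= M -> compact (backward_cone A M t0 x0).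
Proof.
move=> M0; pose P := `[0, t0] `*` closed_ball_ (fun x : 'rV[R]_n => `|x|) x0 (M * t0).
have cf : continuous (fst : R * 'rV[R]_n -> R) by move=> z; exact: cvg_fst.
have cs : continuous (snd : R * 'rV[R]_n -> 'rV[R]_n) by move=> z; exact: cvg_snd.
apply: (@subclosed_compact _ _ P).
- have -> : backward_cone A M t0 x0 =
     [set z | 0 <= z.1] `&` [set z | z.1 <= t0] `&` snd @^-1` (closure A)
     `&` [set z | `|z.2 - x0| <= M * (t0 - z.1)].
    by apply/seteqP; split=> z /= => [[]|[[[]]]].
  apply: closedI; first apply: closedI; first apply: closedI.
  + by apply: closed_le_fun => //; exact: cst_continuous.
  + by apply: closed_le_fun => //; exact: cst_continuous.
  + by apply: closed_comp => [z _|]; [exact: cs|exact: closed_closure].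
  + apply: closed_le_fun => z.
      apply: (@continuous_comp _ _ _ (fun z : R * 'rV[R]_n => z.2 - x0));
        last exact: norm_continuous.
      by apply: continuousB; [exact: cs|exact: cst_continuous].
    apply: (@continuousM _ _ (fun=> M) (fun z : R * 'rV[R]_n => t0 - z.1)).
      exact: cst_continuous.
    by apply: continuousB; [exact: cst_continuous|exact: cf].
- apply: compact_setX; first exact: segment_compact.
  apply: bounded_closed_compact; last exact: closed_closed_ball_.
  exists (M * t0 + `|x0|); split; first exact: num_real.
  move=> r rM x /= xb; apply: le_trans (ltW rM).
  have tri : `|x| <= `|x - x0| + `|x0|.
    by rewrite -[X in `|X| <= _](subrK x0 x) ler_normD.
  by apply: le_trans tri _; rewrite lerD2r distrC.
- move=> [t x] [/= t1 t2 _ tx]; split => /=; first by rewrite in_itv /= t1.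
  rewrite /closed_ball_ /= distrC (le_trans tx)// ler_wpM2l// lerBlDr lerDl//.
Qed.

(** The contradiction at a positive maximum [m] of [exp (- (C + 1) t) * phi].  A
    step of length [s] backwards leads to a value [p] of [phi] that is at least
    [m - s * (C * m + m / 2)], where [m / 2] is the error allowed in the
    derivative, while maximality gives [E * p <= m] with
    [E = exp ((C + 1) * s) >= 1 + (C + 1) * s].  To first order in [s] this reads
    [(C + 1) * m <= (C + 1 / 2) * m]; the bound on [s] absorbs the second-order
    term. *)
Lemma backward_decay (C m p s E : R) : 0 <= C -> 0 < m -> 0 < s ->
  s * ((C + 1) * (C + 1)) * 2 <= 1 ->
  0 <= p -> m - s * (C * m + m / 2) <= p -> 1 + (C + 1) * s <= E -> E * p <= m -> False.
Proof.
move=> C0 m0 s0 sC p0 mp sE Em.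
set D := C + 1 in sC sE *.
have D1 : 1 <= D by rewrite lerDr.
have H1 : (1 + D * s) * (m - s * (C * m + m / 2)) <= m.
  apply: le_trans Em; apply: le_trans (ler_wpM2r p0 sE).
  rewrite ler_wpM2l// addr_ge0// mulr_ge0//; lra.
have H2 : m * s * (1 / 2 - D * s * (C + 1 / 2)) <= 0.
  have -> : m * s * (1 / 2 - D * s * (C + 1 / 2)) =
    (1 + D * s) * (m - s * (C * m + m / 2)) - m by rewrite /D; field.
  by rewrite subr_le0.
have ms : 0 < m * s by rewrite mulr_gt0.
have : 1 / 2 - D * s * (C + 1 / 2) <= 0 by rewrite -(pmulr_rle0 _ ms).
have Ds : 0 < D * s by rewrite mulr_gt0//; lra.
have -> : C + 1 / 2 = D - 1 / 2 by rewrite /D; field.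
move: sC; rewrite (_ : s * (D * D) * 2 = D * s * D * 2); last by ring.
rewrite mulrBr; lra.
Qed.

End Cone.

(** * A maximum principle for transport inequalities *)

Section MaxPrinciple.
Context {R : realType} {n : nat}.
Implicit Types (A : set 'rV[R]_n) (T : \bar R).

(** Points of [A] near [x1] may be moved by [- r *: w1] without leaving [A]: for
    [x1] in [A] because [A] is open, and otherwise because [w1] is zero.  This
    treats interior and boundary points alike. *)
Lemma shift_room A (x1 w1 : 'rV[R]_n) : open A -> (~ A x1 -> w1 = 0) ->
  exists2 d, 0 < d & forall x r, A x -> `|x - x1| < d -> 0 <= r < d -> A (x - r *: w1).
Proof.
move=> oA w0; have [Ax1|nAx1] := pselect (A x1); last first.
  by exists 1 => // x r Ax _ _; rewrite w0// scaler0 subr0.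
have [e e0 H] := @open_norm _ _ _ _ oA Ax1.
have k0 : 0 < `|w1| + 1 by rewrite ltr_wpDl.
have k1 : 1 <= `|w1| + 1 by rewrite lerDr.
exists (e / 2 / (`|w1| + 1)); first by rewrite !divr_gt0.
move=> x r Ax xd /andP[r0 rd]; apply: H.
have xe : `|x - x1| < e / 2.
  by apply: lt_le_trans xd _; rewrite ler_pdivrMr// ler_peMr// divr_ge0// ltW.
have re : r * `|w1| < e / 2.
  move: rd; rewrite ltr_pdivlMr// => /(le_lt_trans _); apply.
  by rewrite ler_wpM2l// lerDl.
have tri : `|x - r *: w1 - x1| <= `|x - x1| + r * `|w1|.
  by rewrite addrAC (le_trans (ler_normB _ _))// normrZ (ger0_norm r0).
by apply: le_lt_trans tri _; rewrite [e]splitr ltrD.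
Qed.

Lemma derive_advection (S : set (R * 'rV[R]_n)) (phi : R * 'rV[R]_n -> R) z
    (w v : 'rV[R]_n) :
  open S -> C1_on S phi -> S z ->
  'D_((1, w) : R * 'rV[R]_n) phi z = 'D_((1, v) : R * 'rV[R]_n) phi z
    + \sum_(k < n) (w 0 k - v 0 k) * 'D_(edir k) phi z.
Proof.
move=> oS cphi Sz; rewrite -(derive_linear_comb S)//.
suff -> : ((1, w) : R * 'rV[R]_n) = (1, v) + \sum_(k < n) (w 0 k - v 0 k) *: edir k by [].
rewrite (eq_bigr (fun k => (w - v) 0 k *: edir k)); last by move=> k _; rewrite !mxE.
rewrite sum_edir; congr pair; first by rewrite addr0.
by rewrite addrC subrK.
Qed.

(** [phib] is the extension of [phi] to [t = 0] and to the lateral boundary.  The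
    bound [M] on [w] fixes the slope of the cone, so that backward steps along
    [(1, w)] stay inside it. *)
Lemma transport_max_principle A T (w : R -> 'rV[R]_n -> 'rV[R]_n) (M C t0 : R)
    (phi phib : R * 'rV[R]_n -> R) (x0 : 'rV[R]_n) :
  open A ->
  (forall k, {within spacetime T (closure A),
     continuous (fun z : R * 'rV[R]_n => w z.1 z.2 0 k)}) ->
  (forall t x, 0 <= t <= t0 -> A x -> `|w t x| <= M) ->
  (forall t x, 0 <= t -> (t%:E < T)%E -> closure A x -> ~ A x -> w t x = 0) ->
  Ck_extends 1 (spacetime_interior T A) (spacetime T (closure A)) phi ->
  {within spacetime T (closure A), continuous phib} ->
  (forall z, spacetime_interior T A z -> phi z = phib z) ->
  (forall z, 0 <= phib z) ->
  0 <= C ->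
  (forall z, spacetime_interior T A z -> z.1 <= t0 ->
     'D_((1, w z.1 z.2) : R * 'rV[R]_n) phi z <= C * phi z) ->
  (forall x, A x -> phib (0, x) <= 0) ->
  0 <= t0 -> (t0%:E < T)%E -> A x0 -> phib (t0, x0) = 0.
Proof.
move=> oA cw wM w0 dphi cphib phiE phib0 C0 Dphi init t00 t0T Ax0.
apply/eqP; rewrite eq_le phib0 andbT leNgt; apply/negP => pos.
set B := spacetime T (closure A) in cw dphi cphib *.
set I := spacetime_interior T A in dphi phiE Dphi *.
have oI : open I by apply: open_spacetime_interior.
have IB : I `<=` B by apply: spacetime_interior_sub.
have M0 : 0 <= M by apply: le_trans (normr_ge0 _) (wM 0 x0 _ Ax0); rewrite lexx.
pose K := backward_cone A M t0 x0.
have KB : K `<=` B.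
  move=> z [z0 zt0 Az _]; split=> //; apply: le_lt_trans t0T.
  by rewrite lee_fin.
pose c := C + 1.
pose psi (z : R * 'rV[R]_n) := expR (- c * z.1) * phib z.
have cpsi : {within K, continuous psi}.
  apply: (continuous_subspaceW KB); apply: withinM => //.
  apply: continuous_subspaceT => z.
  apply: (@continuous_comp _ _ _ (fun z : R * 'rV[R]_n => - c * z.1));
    last exact: continuous_expR.
  apply: (@continuousM _ _ (fun=> - c) (fun z : R * 'rV[R]_n => z.1)).
    exact: cst_continuous.
  exact: cvg_fst.
have K0 : K (t0, x0).
  by split=> //=; [exact: subset_closure|rewrite !subrr normr0 mulr0].
have [|[t1 x1] /set_mem Kz1 max1] :=
    compact_EVT_max _ (@compact_backward_cone _ _ A M t0 x0 M0) cpsi.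
  by exists (t0, x0).
set z1 : R * 'rV[R]_n := (t1, x1) in Kz1 max1 *.
have {}max1 z : K z -> psi z <= psi z1 by move=> Kz; apply: max1; exact: mem_set.
have m0 : 0 < phib z1.
  have : 0 < psi z1 by apply: lt_le_trans (max1 _ K0); rewrite mulr_gt0// expR_gt0.
  by rewrite /psi pmulr_rgt0// expR_gt0.
have [/= t10 t1t0 Ax1 x1cone] := Kz1.
have Bz1 : B z1 by apply: KB.
have t1T : (t1%:E < T)%E by have [] := Bz1.
have {t10}t10 : 0 < t1.
  rewrite lt_neqAle t10 andbT; apply/eqP => t1E.
  suff : phib z1 <= 0 by rewrite leNgt m0.
  apply: (@within_closure_le0 _ _ B [set z : R * 'rV[R]_n | z.1 = 0 /\ A z.2]) => //.
  - move=> z [z0 Az]; split; rewrite ?z0//; last exact: subset_closure.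
    by apply: le_lt_trans t0T; rewrite lee_fin.
  - apply: norm_closure => e e0; have [x Ax xe] := @closure_norm _ _ _ _ _ Ax1 e0.
    by exists (0, x) => //; rewrite norm_pair_lt /= -t1E subrr normr0 e0.
  - by move=> [t x] [/= -> Ax]; apply: init.
pose w1 := w t1 x1.
pose u : R * 'rV[R]_n := (1, w1).
have w1M : `|w1| <= M.
  have [Ax|nAx] := pselect (A x1); first by apply: wM => //; rewrite ltW.
  by rewrite /w1 w0 ?normr0// ltW.
have cC1 : C1_on I phi by apply: Ck_extends_C1_on IB dphi.
have [du [[g cg ge] _]] := dphi.2 u.
pose ext k (f : R * 'rV[R]_n -> R) := {within B, continuous f} /\
  (forall z, I z -> 'D_(edir k) phi z = f z).
have /choice[gk gkP] : forall k, exists f, ext k f.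
  by move=> k; have [_ [[h ch he] _]] := dphi.2 (edir k); exists h.
have cgk k := (gkP k).1; have gke k := (gkP k).2.
(* Near [z1] the frozen direction [u] differs from [(1, w)] by a spatial vector
   that tends to zero, while the spatial derivatives [gk] stay bounded; hence the
   differential inequality passes to the limit [z1]. *)
have gz1 : g z1 <= C * phib z1.
  pose h z := g z - C * phib z - \sum_(k < n) (w1 0 k - w z.1 z.2 0 k) * gk k z.
  suff : h z1 <= 0.
    by rewrite /h big1 ?subr0 ?subr_le0// => k _; rewrite /w1 subrr mul0r.
  apply: (@within_closure_le0 _ _ B [set z | I z /\ z.1 = t1]) => //.
  - apply: withinB; first by apply: withinB => //; apply: withinM => //; apply: within_cst.
    apply: within_sum => k; apply: withinM => //; apply: withinB => //.
    exact: within_cst.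
  - by move=> z [Iz _]; apply: IB.
  - apply: norm_closure => e e0; have [x Ax xe] := @closure_norm _ _ _ _ _ Ax1 e0.
    by exists (t1, x) => //; rewrite norm_pair_lt /= subrr normr0 e0.
  - move=> z [Iz zt1]; rewrite /h -ge// -phiE//.
    rewrite (@derive_advection I _ z _ (w z.1 z.2))//.
    under [X in _ - X]eq_bigr do rewrite -gke//.
    by rewrite addrAC addrK subr_le0; apply: Dphi => //; rewrite zt1.
have [d d0 Hd] := @shift_room A x1 w1 oA (fun nA => w0 t1 x1 (ltW t10) t1T Ax1 nA).
have e0 : 0 < phib z1 / 2 by rewrite divr_gt0.
have [d' d'0 Hd'] := @within_continuous_norm _ _ _ _ _ _ cg Bz1 e0.
have cc0 : 0 < (C + 1) * (C + 1) * 2 by rewrite !mulr_gt0//; lra.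
have k0 : 0 < `|w1| + 1 by rewrite ltr_wpDl.
(* The bounds on [s] are, in order: room inside [A], positive times, closeness of
   [g] to [g z1] along the step, and the second-order term of [backward_decay]. *)
pose S := Num.min (Num.min d (t1 / 2))
  (Num.min (d' / 2 / (`|w1| + 1)) ((C + 1) * (C + 1) * 2)^-1).
pose s := S / 2.
have S0 : 0 < S by rewrite !lt_min d0 !divr_gt0// invr_gt0.
have s0 : 0 < s by rewrite divr_gt0.
have : s < S by rewrite ltr_pdivrMr// ltr_pMr// ltr1n.
rewrite !lt_min => /andP[/andP[sd st1] /andP[sd' sC]].
pose a := z1 - s *: u.
have aE : a = (t1 - s, x1 - s *: w1) by congr pair => //=; rewrite /GRing.scale /= mulr1.
have auE : a + s *: u = z1 by rewrite subrK.
have st1' : s < t1 by apply: lt_trans st1 _; rewrite ltr_pdivrMr// ltr_pMr// ltr1n.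
have Ka : K a.
  rewrite aE; split=> /=.
  - by rewrite subr_ge0 ltW.
  - by rewrite lerBlDr (le_trans t1t0)// lerDl ltW.
  - apply: norm_closure => e e0'.
    have de0 : 0 < Num.min d e by rewrite lt_min d0.
    have [x Ax] := @closure_norm _ _ _ _ _ Ax1 de0.
    rewrite lt_min => /andP[xd xe]; exists (x - s *: w1).
      by apply: Hd => //; rewrite ltW.
    by rewrite opprB addrA subrK.
  - have tri : `|x1 - s *: w1 - x0| <= `|x1 - x0| + s * `|w1|.
      by rewrite addrAC (le_trans (ler_normB _ _))// normrZ gtr0_norm.
    have sw : s * `|w1| <= M * s by rewrite mulrC ler_wpM2r// ltW.
    apply: le_trans tri _; move: x1cone => /= x1cone.
    by rewrite (_ : t0 - (t1 - s) = t0 - t1 + s) 1?mulrDr ?lerD//; ring.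
have inc : `|phib z1 - phib a - s * g z1| <= s * (phib z1 / 2).
  rewrite -[X in phib X - _]auE.
  apply: (@increment_closure _ _ I B phi phib) => //.
  - exact: ltW.
  - exact: (KB a Ka).
  - by rewrite auE.
  have dd0 : 0 < Num.min d (d' / 2) by rewrite lt_min d0 divr_gt0.
  apply: norm_closure => e e0'.
  have de0 : 0 < Num.min e (Num.min d (d' / 2)) by rewrite lt_min e0'.
  have [x Ax] := @closure_norm _ _ _ _ _ Ax1 de0.
  rewrite !lt_min => /and3P[xe xd xd'].
  exists (t1 - s, x - s *: w1); last first.
    rewrite aE norm_pair_lt /= subrr normr0 e0' /=.
    by rewrite opprB addrA subrK.
  move=> r /andP[r0 rs] /=.
  have zE : ((t1 - s, x - s *: w1) : R * 'rV[R]_n) + r *: u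
      = (t1 - (s - r), x - (s - r) *: w1).
    congr pair => /=.
      by rewrite (_ : r%:A = r) ?opprB ?addrA 1?addrAC//; exact: mulr1.
    by rewrite scalerBl opprB addrA addrAC.
  rewrite zE.
  have Iz : I (t1 - (s - r), x - (s - r) *: w1).
    split=> /=; first lra.
      by apply: le_lt_trans t1T; rewrite lee_fin; lra.
    by apply: Hd => //; apply/andP; split; lra.
  split=> //; rewrite ge//; apply/ltW/Hd'; first exact: IB.
  have sr : 0 <= s - r by rewrite subr_ge0.
  have srs : s - r <= s by lra.
  move: sd'; rewrite ltr_pdivlMr// mulrDr mulr1 => sd'.
  have sw0 : 0 <= s * `|w1| by rewrite mulr_ge0// ltW.
  have srw : (s - r) * `|w1| <= s * `|w1| by rewrite ler_wpM2r.
  rewrite norm_pair_lt /=; apply/andP; split.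
    by rewrite ltr_norml; apply/andP; split; lra.
  have tri : `|x - (s - r) *: w1 - x1| <= `|x - x1| + (s - r) * `|w1|.
    by rewrite addrAC (le_trans (ler_normB _ _))// normrZ (ger0_norm sr).
  apply: le_lt_trans tri _; lra.
apply: (@backward_decay R C (phib z1) (phib a) s (expR (c * s))) => //.
- rewrite -mulrA -ler_pdivlMr ?mul1r; first exact: ltW.
  exact: cc0.
- move: inc; rewrite ler_norml => /andP[_].
  have : s * g z1 <= s * (C * phib z1) by rewrite ler_pM2l.
  rewrite [s * (_ + _)]mulrDr; lra.
- exact: expR_ge1Dx.
- have := max1 _ Ka; rewrite /psi aE /= mulrBr expRD -aE mulrAC -mulrA.
  rewrite ler_pM2l ?expR_gt0//.
  by rewrite mulrC mulNr opprK.
Qed.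

End MaxPrinciple.

(** * Transport of the brackets of the columns of [F] *)

(** With [dF l i j = d_l F_ij], [dv k i = d_k v_i] and [ddv l k i = d_l d_k v_i],
    the left-hand side is the material derivative of
    [sum_l F l m * d_l F i j], computed from the transport equation.  The terms in
    which [v] transports the differentiation index cancel after exchanging [l]
    and [k]. *)
Lemma bracket_identity_half {R : comRingType} {n : nat} (F dv : 'I_n -> 'I_n -> R)
    (dF ddv : 'I_n -> 'I_n -> 'I_n -> R) (i j m : 'I_n) :
  \sum_(l < n) ((\sum_(k < n) dv k l * F k m) * dF l i j
     + F l m * \sum_(k < n) (ddv l k i * F k j + dv k i * dF l k j - dv l k * dF k i j))
  = \sum_(l < n) \sum_(k < n) ddv l k i * F l m * F k j
    + \sum_(k < n) dv k i * \sum_(l < n) F l m * dF l k j.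
Proof.
under eq_bigr => l _ do rewrite mulr_suml mulr_sumr -big_split /=.
rewrite [X in _ + X](_ : _ =
  \sum_(l < n) \sum_(k < n) dv k i * (F l m * dF l k j)); last first.
  by rewrite exchange_big; apply: eq_bigr => k _; rewrite mulr_sumr.
rewrite -big_split /=.
under [RHS]eq_bigr => l _ do rewrite -big_split /=.
apply/eqP; rewrite -subr_eq0 -sumrB.
under eq_bigr => l _ do rewrite -sumrB.
rewrite (eq_bigr (fun l => \sum_(k < n) (dv k l * F k m * dF l i j)
    - \sum_(k < n) (dv l k * F l m * dF k i j))); last first.
  by move=> l _; rewrite -sumrB; apply: eq_bigr => k _; ring.
by rewrite sumrB exchange_big subrr.
Qed.

(** The remaining second-order term is symmetric in [j] and [m] because second
    derivatives commute; antisymmetrization removes it. *)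
Lemma bracket_identity {R : comRingType} {n : nat} (F dv : 'I_n -> 'I_n -> R)
    (dF ddv : 'I_n -> 'I_n -> 'I_n -> R) (i j m : 'I_n) :
  (forall l k, ddv l k i = ddv k l i) ->
  \sum_(l < n) ((\sum_(k < n) dv k l * F k m) * dF l i j
     + F l m * \sum_(k < n) (ddv l k i * F k j + dv k i * dF l k j - dv l k * dF k i j))
  - \sum_(l < n) ((\sum_(k < n) dv k l * F k j) * dF l i m
     + F l j * \sum_(k < n) (ddv l k i * F k m + dv k i * dF l k m - dv l k * dF k i m))
  = \sum_(k < n) dv k i * \sum_(l < n) (F l m * dF l k j - F l j * dF l k m).
Proof.
move=> sym; rewrite !bracket_identity_half.
have -> : \sum_(l < n) \sum_(k < n) ddv l k i * F l j * F k m
        = \sum_(l < n) \sum_(k < n) ddv l k i * F l m * F k j.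
  rewrite exchange_big; apply: eq_bigr => l _; apply: eq_bigr => k _.
  by rewrite sym mulrAC.
rewrite opprD addrACA subrr add0r -sumrB; apply: eq_bigr => k _.
by rewrite -mulrBr -sumrB.
Qed.

Lemma sum_transpose {R : zmodType} {n : nat} (p q : 'I_n -> R) (a s : R) :
  a + \sum_(k < n) (p k + q k) = s ->
  a + \sum_(k < n) q k = s - \sum_(k < n) p k.
Proof. by move=> <-; rewrite big_split /= addrCA [RHS]addrC addKr. Qed.

Section Bracket.
Context {R : realType} {V : normedModType R} {n : nat}.
Implicit Types (S : set V) (z u : V).

Lemma is_derive_sumM (b c : 'I_n -> V -> R) (b' c' : 'I_n -> R) z u :
  (forall k, is_derive z u (b k) (b' k)) -> (forall k, is_derive z u (c k) (c' k)) ->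
  is_derive z u (fun y => \sum_(k < n) b k y * c k y)
    (\sum_(k < n) (b' k * c k z + b k z * c' k)).
Proof.
move=> db dc; rewrite -fct_sumE.
apply: is_derive_sum => k.
have -> : b' k * c k z + b k z * c' k = b k z *: c' k + c k z *: b' k.
  by rewrite /GRing.scale /= addrC [c k z * _]mulrC.
exact: (is_deriveM (db k) (dc k)).
Qed.

Definition C2_on S (f : V -> R) := C1_on S f /\ forall u, C1_on S ('D_u f).

Lemma Ck_extends_C2_on S B (f : V -> R) : open S -> S `<=` B ->
  Ck_extends 2 S B f -> C2_on S f.
Proof.
move=> oS SB df; split; first exact: Ck_extends_C1_on (Ck_extendsW _ _ _ _ df).
by move=> u; apply: Ck_extends_C1_on (df.2 u).2.
Qed.

Lemma derive_eq_on S (f g : V -> R) z u : open S -> S z ->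
  (forall y, S y -> f y = g y) -> 'D_u f z = 'D_u g z.
Proof.
move=> oS Sz fg; have [->|u0] := eqVneq u 0; first by rewrite !derive0.
apply: near_eq_derive => //.
have [d d0 H] := open_norm _ _ oS Sz.
by apply/nbhs_normP; exists d => // y /= yz; apply/fg/H; rewrite distrC.
Qed.

(** The [i]-th component of the Lie bracket of columns [m] and [j] of [F]. *)
Definition bracket (e : 'I_n -> V) (F : 'I_n -> 'I_n -> V -> R) (i j m : 'I_n) z : R :=
  \sum_(l < n) (F l m z * 'D_(e l) (F i j) z - F l j z * 'D_(e l) (F i m) z).

(** [u0] is the time direction and the [e k] are the space directions, so that
    [u0 + \sum_k v k z *: e k] is the direction of the material derivative at
    [z]. *)
Lemma derive_bracket S (u0 : V) (e : 'I_n -> V) (F : 'I_n -> 'I_n -> V -> R)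
    (v : 'I_n -> V -> R) :
  open S -> (forall i j, C2_on S (F i j)) -> (forall i, C2_on S (v i)) ->
  (forall z i j, S z -> 'D_u0 (F i j) z + \sum_(k < n) v k z * 'D_(e k) (F i j) z
     = \sum_(k < n) 'D_(e k) (v i) z * F k j z) ->
  forall z i j m, S z ->
  derivable (bracket e F i j m) z (u0 + \sum_(k < n) v k z *: e k) /\
  'D_(u0 + \sum_(k < n) v k z *: e k) (bracket e F i j m) z
  = \sum_(k < n) 'D_(e k) (v i) z * bracket e F k j m z.
Proof.
move=> oS cF cv transport z i j m Sz.
set w := u0 + _.
have Dw (f : V -> R) : C1_on S f ->
    'D_w f z = 'D_u0 f z + \sum_(k < n) v k z * 'D_(e k) f z.
  by move=> cf; apply: (derive_linear_comb S).
have dF i' j' u : is_derive z u (F i' j') ('D_u (F i' j') z).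
  by apply: derivableP; apply: ((cF i' j').1 u z Sz).1.
have ddF i' j' u u' : is_derive z u ('D_u' (F i' j')) ('D_u ('D_u' (F i' j')) z).
  by apply: derivableP; apply: ((cF i' j').2 u' u z Sz).1.
have dv i' u : is_derive z u (v i') ('D_u (v i') z).
  by apply: derivableP; apply: ((cv i').1 u z Sz).1.
have ddv i' u u' : is_derive z u ('D_u' (v i')) ('D_u ('D_u' (v i')) z).
  by apply: derivableP; apply: ((cv i').2 u' u z Sz).1.
have DF i' j' : 'D_w (F i' j') z = \sum_(k < n) 'D_(e k) (v i') z * F k j' z.
  by rewrite Dw; [exact: transport|exact: (cF i' j').1].
(* Differentiate the transport equation along [e l] and commute derivatives. *)
have DDF l i' j' : 'D_w ('D_(e l) (F i' j')) z =
   \sum_(k < n) ('D_(e l) ('D_(e k) (v i')) z * F k j' z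
     + 'D_(e k) (v i') z * 'D_(e l) (F k j') z
     - 'D_(e l) (v k) z * 'D_(e k) (F i' j') z).
  rewrite Dw; last exact: (cF i' j').2.
  have := derive_eq_on _ _ _ z (e l) oS Sz (fun y => transport y i' j').
  have -> := @derive_val _ _ _ _ _ _ _ (is_derive_sumM _ _ _ _ _ _
     (fun k => ddv i' (e l) (e k)) (fun k => dF k j' (e l))).
  have -> := @derive_val _ _ _ _ _ _ _ (is_deriveD (ddF i' j' (e l) u0)
    (is_derive_sumM _ _ _ _ _ _
     (fun k => dv k (e l)) (fun k => ddF i' j' (e l) (e k)))).
  move=> /sum_transpose eq_l.
  rewrite sumrB; apply: etrans eq_l.
  have comm u : 'D_u ('D_(e l) (F i' j')) z = 'D_(e l) ('D_u (F i' j')) z.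
    by apply: (derive_derive_comm S) => //; [exact: (cF i' j').1| |]; apply: (cF i' j').2.
  apply: (f_equal2 +%R (comm u0)); apply: eq_bigr => k _.
  exact: (f_equal ( *%R (v k z)) (comm (e k))).
have E : bracket e F i j m =
    (fun y => \sum_(l < n) F l m y * 'D_(e l) (F i j) y)
    - (fun y => \sum_(l < n) F l j y * 'D_(e l) (F i m) y).
  by apply/funext => y; rewrite /bracket sumrB.
have DH := is_deriveB
  (is_derive_sumM _ _ _ _ z w (fun l => dF l m w) (fun l => ddF i j w (e l)))
  (is_derive_sumM _ _ _ _ z w (fun l => dF l j w) (fun l => ddF i m w (e l))).
rewrite E; split; first exact: ex_derive.
apply: etrans (@derive_val _ _ _ _ _ _ _ DH) _.
have term j' m' l : 'D_w (F l m') z * 'D_(e l) (F i j') z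
      + F l m' z * 'D_w ('D_(e l) (F i j')) z
    = (\sum_(k < n) 'D_(e k) (v l) z * F k m' z) * 'D_(e l) (F i j') z
      + F l m' z * \sum_(k < n) ('D_(e l) ('D_(e k) (v i)) z * F k j' z
     + 'D_(e k) (v i) z * 'D_(e l) (F k j') z
     - 'D_(e l) (v k) z * 'D_(e k) (F i j') z).
  exact: (f_equal2 (fun p q => p * 'D_(e l) (F i j') z + F l m' z * q)
    (DF l m') (DDF l i j')).
apply: etrans (f_equal2 (fun p q => p - q)
  (eq_bigr _ (fun l _ => term j m l)) (eq_bigr _ (fun l _ => term m j l))) _.
apply: (bracket_identity (fun k j => F k j z) (fun k i => 'D_(e k) (v i) z)
  (fun l i j => 'D_(e l) (F i j) z) (fun l k i => 'D_(e l) ('D_(e k) (v i)) z)).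
move=> l k; apply: (derive_derive_comm S) => //; first exact: (cv i).1.
  exact: (cv i).2.
exact: (cv i).2.
Qed.

End Bracket.

(** * Partial derivatives as derivatives in space-time *)

Section SpaceTimeDerivatives.
Context {R : realType} {n : nat}.
Implicit Types (A : set 'rV[R]_n) (T : \bar R).

Lemma dt_derive (f : R -> 'rV[R]_n -> R) t x :
  dt f t x = 'D_((1, 0) : R * 'rV[R]_n) (fun z : R * 'rV[R]_n => f z.1 z.2) (t, x).
Proof.
rewrite /dt derive1E /derive.
suff -> : (fun h : R => h^-1 *: (f (h *: 1 + t) x - f t x)) =
  (fun h : R => h^-1 *: (f (h *: 1 + t) (h *: (0 : 'rV[R]_n) + x) - f t x)) by [].
by apply/funext => h; rewrite scaler0 add0r.
Qed.

Lemma partial_derive (f : R -> 'rV[R]_n -> R) t x k :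
  partial k (f t) x = 'D_(edir k) (fun z : R * 'rV[R]_n => f z.1 z.2) (t, x).
Proof.
rewrite /partial /derive.
suff -> : (fun h : R => h^-1 *: (f t (h *: delta_mx 0 k + x) - f t x)) =
  (fun h : R => h^-1 *: (f (h *: (0 : R) + t)
    (h *: (delta_mx 0 k : 'rV[R]_n) + x) - f t x)) by [].
by apply/funext => h; rewrite scaler0 add0r.
Qed.

Lemma partial_subr_cst (f : 'rV[R]_n -> R) (c : R) x k :
  partial k (fun y => f y - c) x = partial k f x.
Proof.
rewrite /partial /derive.
suff -> : (fun h : R => h^-1 *: (f (h *: delta_mx 0 k + x) - c - (f x - c))) =
  (fun h : R => h^-1 *: (f (h *: delta_mx 0 k + x) - f x)) by [].
by apply/funext => h; rewrite opprB addrA subrK.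
Qed.

(** At [t = 0] the function [f] is only known to be continuous; the increments of
    [f (0, _)] along [e] are limits of the increments of [f (t, _)] as [t] tends
    to zero. *)
Lemma initial_derive A T (f g : R * 'rV[R]_n -> R) (e x : 'rV[R]_n) :
  open A -> (0 < T)%E ->
  {within spacetime T (closure A), continuous f} ->
  {within spacetime T (closure A), continuous g} ->
  (forall z, spacetime_interior T A z -> derivable f z (0, e)) ->
  (forall z, spacetime_interior T A z -> 'D_((0, e) : R * 'rV[R]_n) f z = g z) ->
  A x -> 'D_((0, e) : R * 'rV[R]_n) f (0, x) = g (0, x).
Proof.
move=> oA T0 cf cg df dg Ax.
set B := spacetime T (closure A) in cf cg *.
set I := spacetime_interior T A in df dg *.
set u : R * 'rV[R]_n := (0, e).
have IB : I `<=` B by apply: spacetime_interior_sub.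
have [tau tau0 tauT] := lte_fin_open _ _ T0.
have B0 y : A y -> B (0, y) by move=> Ay; split=> //; exact: subset_closure.
suff H : forall eps, 0 < eps -> exists2 d, 0 < d & forall h, 0 < `|h| < d ->
    `|f ((0, x) + h *: u) - f (0, x) - h * g (0, x)| <= `|h| * eps.
  exact: (derive_from_approx _ _ _ _ H).2.
move=> eps eps0.
have [d1 d10 H1] := within_continuous_norm _ _ _ _ cg (B0 _ Ax) eps0.
have [d2 d20 H2] := open_norm _ _ oA Ax.
have k0 : 0 < `|e| + 1 by rewrite ltr_wpDl.
pose d := Num.min d1 d2 / (`|e| + 1).
have d0 : 0 < d by rewrite divr_gt0// lt_min d10.
have near_x r : `|r| < d -> A (x + r *: e) /\ `|x + r *: e - x| < d1.
  rewrite ltr_pdivlMr// lt_min => /andP[rd1 rd2].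
  have re : `|x + r *: e - x| <= `|r| * (`|e| + 1).
    by rewrite addrC addKr normrZ ler_wpM2l// lerDl.
  split; first by apply: H2; apply: le_lt_trans re rd2.
  exact: le_lt_trans re rd1.
have shift r (t : R) : (t, x) + r *: u = (t, x + r *: e).
  by congr pair; rewrite /= scaler0 addr0.
(* [increment_closure] only moves forward; the origin is an endpoint of the step,
   the starting one for [r = 0] and the final one for [r + h = 0]. *)
have forward r h : 0 <= h -> `|r| < d -> `|r + h| < d ->
    `|f ((0, x) + (r + h) *: u) - f ((0, x) + r *: u) - h * g (0, x)| <= h * eps.
  move=> h0 rd rhd.
  rewrite scalerDl addrA.
  apply: (increment_closure I B f f) => //.
  - by rewrite shift; apply: B0; apply: (near_x r rd).1.
  - by rewrite -addrA -scalerDl shift; apply: B0; apply: (near_x _ rhd).1.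
  apply: norm_closure => e' e'0.
  pose t := Num.min (Num.min tau e') d1 / 2.
  have m0 : 0 < Num.min (Num.min tau e') d1 by rewrite !lt_min tau0 e'0.
  have t0 : 0 < t by rewrite divr_gt0.
  have : t < Num.min (Num.min tau e') d1 by rewrite ltr_pdivrMr// ltr_pMr// ltr1n.
  rewrite !lt_min => /andP[/andP[ttau te'] td1].
  exists ((t, x) + r *: u); last first.
    by rewrite !shift norm_pair_lt /= subr0 gtr0_norm// te' subrr normr0.
  move=> s /andP[s0 sh]; rewrite -addrA -scalerDl shift.
  have rsd : `|r + s| < d.
    move: rd rhd; rewrite !ltr_norml => /andP[? ?] /andP[? ?].
    by apply/andP; split; lra.
  have [Ars rs1] := near_x _ rsd.
  have Iz : I (t, x + (r + s) *: e).
    by split=> //=; apply: tauT; rewrite add0r.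
  split=> //; rewrite dg//; apply/ltW/H1; first exact: IB.
  by rewrite norm_pair_lt /= subr0 gtr0_norm// td1.
have origin : (0, x) + 0 *: u = (0, x) by rewrite scale0r addr0.
exists d => // h /andP[h0 hd].
have d00 : `|0 : R| < d by rewrite normr0.
have [hge|hlt] := leP 0 h.
  have := forward 0 h hge d00; rewrite add0r => /(_ hd).
  by rewrite origin (ger0_norm hge).
have hge : 0 <= - h by rewrite oppr_ge0 ltW.
have := forward h (- h) hge hd; rewrite subrr => /(_ d00).
rewrite origin (ltr0_norm hlt) => fwd.
have neg (p q r : R) : p - q - h * r = - (q - p - (- h) * r) by ring.
by rewrite neg normrN.
Qed.

(** With [Fm = 1 + Em], the identity part of [Fm] contributes the left-hand side of
    the compatibility condition. *)
Lemma bracket_compat (Fm Em : 'M[R]_n) (d : 'I_n -> 'I_n -> 'I_n -> R) i j m :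
  Em = Fm - 1%:M ->
  (d m i j - d j i m = \sum_(l < n) Em l j * d l i m - \sum_(l < n) Em l m * d l i j)
  <-> \sum_(l < n) (Fm l m * d l i j - Fm l j * d l i m) = 0.
Proof.
move=> ->.
have key a (h : 'I_n -> R) : \sum_(l < n) (Fm - 1%:M) l a * h l =
    \sum_(l < n) Fm l a * h l - h a.
  under eq_bigr => l _ do rewrite !mxE mulrBl.
  rewrite sumrB (bigD1 a) //= [X in _ - X](bigD1 a) //= eqxx mul1r.
  by rewrite [X in _ - (_ + X)]big1 ?addr0// => l /negPf ->; rewrite mul0r.
rewrite !key sumrB; split => [E|E].
  set p := \sum_(l < n) _ in E *; set q := \sum_(l < n) _ in E *.
  lra.
set p := \sum_(l < n) _ in E *; set q := \sum_(l < n) _ in E *.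
lra.
Qed.

(** Young's inequality [2 c p q <= M (p^2 + q^2)] for [|c| <= M], summed over all
    indices: each square then occurs [2 n] times. *)
Lemma sum3_weighted_le (M : R) (a : 'I_n -> 'I_n -> R) (h : 'I_n -> 'I_n -> 'I_n -> R) :
  (forall k i, `|a k i| <= M) ->
  \sum_(i < n) \sum_(j < n) \sum_(m < n) 2 * (h i j m * \sum_(k < n) a k i * h k j m)
  <= 2 * n%:R * M * \sum_(i < n) \sum_(j < n) \sum_(m < n) h i j m * h i j m.
Proof.
move=> aM; set S := \sum_(i < n) \sum_(j < n) \sum_(m < n) (h i j m * h i j m).
have term i j m : 2 * (h i j m * \sum_(k < n) a k i * h k j m)
   <= \sum_(k < n) (M * (h i j m * h i j m) + M * (h k j m * h k j m)).
  rewrite mulr_sumr mulr_sumr; apply: ler_sum => k _.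
  have := aM k i; rewrite ler_norml => /andP[].
  set p := h i j m; set q := h k j m; set c := a k i => c1 c2.
  have H1 : 0 <= (M - c) * ((p + q) * (p + q)) by rewrite mulr_ge0 ?subr_ge0// -expr2 sqr_ge0.
  have H2 : 0 <= (M + c) * ((p - q) * (p - q)).
    by rewrite mulr_ge0 -?expr2 ?sqr_ge0//; lra.
  nra.
apply: (@le_trans _ _ (\sum_(i < n) \sum_(j < n) \sum_(m < n) \sum_(k < n)
  (M * (h i j m * h i j m) + M * (h k j m * h k j m)))).
  by apply: ler_sum => i _; apply: ler_sum => j _; apply: ler_sum.
suff -> : \sum_(i < n) \sum_(j < n) \sum_(m < n) \sum_(k < n)
  (M * (h i j m * h i j m) + M * (h k j m * h k j m)) = n%:R * (M * S) + n%:R * (M * S).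
  by rewrite le_eqVlt; apply/orP; left; apply/eqP; ring.
pose sq i := \sum_(j < n) \sum_(m < n) h i j m * h i j m.
rewrite (eq_bigr (fun i => \sum_(k < n) (M * sq i + M * sq k))); last first.
  move=> i _; rewrite [RHS](eq_bigr (fun k => \sum_(j < n) \sum_(m < n)
     (M * (h i j m * h i j m) + M * (h k j m * h k j m)))); last first.
    move=> k _; rewrite /sq !mulr_sumr -big_split; apply: eq_bigr => j _.
    by rewrite !mulr_sumr -big_split.
  rewrite [RHS]exchange_big /=; apply: eq_bigr => j _.
  by rewrite exchange_big.
under eq_bigr => i _ do rewrite big_split sumr_const card_ord /=.
rewrite big_split /= sumr_const card_ord -!mulr_sumr -/S.
congr (_ + _); last by rewrite mulr_natl.
by rewrite sumrMnl -mulr_sumr mulr_natl.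
Qed.
End SpaceTimeDerivatives.

(** * Propagation of the compatibility condition *)

Section Propagation.
Context {R : realType} {n : nat}.
Implicit Types (A : set 'rV[R]_n) (T : \bar R).

Lemma ler_mx_entry (X : 'M[R]_n) i j : `|X i j| <= `|X|.
Proof.
rewrite [leRHS]/Num.Def.normr /= mx_normrE.
by apply/bigmax_geP; right => /=; exists (i, j).
Qed.

Lemma is_derive_fct_sum (V : normedModType R) (k : nat) (b : 'I_k -> V -> R)
    (b' : 'I_k -> R) z u :
  (forall i, is_derive z u (b i) (b' i)) ->
  is_derive z u (fun y => \sum_(i < k) b i y) (\sum_(i < k) b' i).
Proof. by move=> db; rewrite -fct_sumE; apply: is_derive_sum. Qed.

Lemma is_derive_sqr (V : normedModType R) (h : V -> R) (h' : R) z u :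
  is_derive z u h h' -> is_derive z u (fun y => h y * h y) (2 * (h z * h')).
Proof.
move=> dh; have -> : 2 * (h z * h') = h z *: h' + h z *: h'.
  by rewrite /GRing.scale /= mulr_natl mulr2n.
exact: (is_deriveM dh dh).
Qed.

Definition column_bracket (F : 'rV[R]_n -> 'M[R]_n) (i j m : 'I_n) (x : 'rV[R]_n) : R :=
  \sum_(l < n) (F x l m * partial l (fun y => F y i j) x
    - F x l j * partial l (fun y => F y i m) x).

(** The maximum principle applied to the sum [phi] of the squares of the brackets;
    its extension [phib] is built from the extensions [G] of the spatial
    derivatives of [F], which at [t = 0] are those of the initial data. *)
Lemma column_bracket_transported A T (v : R -> 'rV[R]_n -> 'rV[R]_n)
    (F : R -> 'rV[R]_n -> 'M[R]_n) :
  open A -> (0 < T)%E ->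
  (forall i, C2_field T A (fun t x => v t x 0 i)) ->
  (forall i j, C2_field T A (fun t x => F t x i j)) ->
  (forall t0, (t0%:E < T)%E -> exists M : R, forall t x, 0 <= t <= t0 -> A x ->
      `|v t x| <= M /\ `|grad_vec (v t) x| <= M) ->
  (forall t x, 0 <= t -> (t%:E < T)%E -> closure A x -> ~ A x -> v t x = 0) ->
  (forall t x i j, 0 < t -> (t%:E < T)%E -> A x ->
     dt (fun s y => F s y i j) t x + advect (v t) (fun y => F t y i j) x
      = (grad_vec (v t) x *m F t x) i j) ->
  (forall x i j m, A x -> column_bracket (F 0) i j m x = 0) ->
  forall t x i j m, 0 <= t -> (t%:E < T)%E -> A x -> column_bracket (F t) i j m x = 0.
Proof.
move=> oA T0 cv cF bounded v_bd transport init t0 x0 i0 j0 m0 t00 t0T Ax0.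
have [<-|t0N] := eqVneq 0 t0; first exact: init.
have t0pos : 0 < t0 by rewrite lt_neqAle t0N.
set B := spacetime T (closure A).
set I := spacetime_interior T A.
have oI : open I by apply: open_spacetime_interior.
have IB : I `<=` B by apply: spacetime_interior_sub.
pose Fz i j (z : R * 'rV[R]_n) := F z.1 z.2 i j.
pose vz i (z : R * 'rV[R]_n) := v z.1 z.2 0 i.
have bracketE t x i j m : column_bracket (F t) i j m x = bracket edir Fz i j m (t, x).
  apply: eq_bigr => l _.
  by rewrite !(partial_derive (fun t x => F t x _ _)).
pose extends u (f g : R * 'rV[R]_n -> R) :=
  {within B, continuous g} /\ (forall z, I z -> 'D_u f z = g z).
have /choice[G GP] : forall p : 'I_n * 'I_n * 'I_n,
    exists g, extends (edir p.1.1) (Fz p.1.2 p.2) g.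
  move=> [[l i] j]; have [_ [[g cg ge] _]] := (cF i j).2.2 (edir l).
  by exists g.
have cG l i j := (GP (l, i, j)).1.
have GE l i j := (GP (l, i, j)).2.
pose Hb i j m z := \sum_(l < n) (Fz l m z * G (l, i, j) z - Fz l j z * G (l, i, m) z).
pose H := bracket edir Fz.
pose phi (z : R * 'rV[R]_n) :=
  \sum_(i < n) \sum_(j < n) \sum_(m < n) (H i j m z * H i j m z).
pose phib z := \sum_(i < n) \sum_(j < n) \sum_(m < n) (Hb i j m z * Hb i j m z).
have HE i j m z : I z -> H i j m z = Hb i j m z.
  by move=> Iz; apply: eq_bigr => l _; rewrite !GE.
have phiE z : I z -> phi z = phib z.
  move=> Iz; apply: eq_bigr => i _; apply: eq_bigr => j _; apply: eq_bigr => m _.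
  by rewrite HE.
have [M bM] := bounded _ t0T.
have C2F i j : C2_on I (Fz i j) := Ck_extends_C2_on _ _ _ oI IB (cF i j).2.
have C2v i : C2_on I (vz i) := Ck_extends_C2_on _ _ _ oI IB (cv i).2.
have transportD z i j : I z -> 'D_((1, 0) : R * 'rV[R]_n) (Fz i j) z
     + \sum_(k < n) vz k z * 'D_(edir k) (Fz i j) z
   = \sum_(k < n) 'D_(edir k) (vz i) z * Fz k j z.
  case: z => t x [/= tp tT Ax]; have := transport t x i j tp tT Ax.
  rewrite dt_derive /advect mxE => E.
  apply: etrans (etrans E _).
    congr (_ + _); apply: eq_bigr => k _.
    by rewrite (partial_derive (fun t x => F t x i j)).
  apply: eq_bigr => k _; rewrite mxE.
  by rewrite (partial_derive (fun t x => v t x 0 i)).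
have dirE z : ((1, v z.1 z.2) : R * 'rV[R]_n) =
    (1, 0) + \sum_(k < n) vz k z *: edir k.
  by rewrite /vz sum_edir; congr pair; rewrite ?addr0 ?add0r.
have DH z i j m : I z -> is_derive z ((1, v z.1 z.2) : R * 'rV[R]_n) (H i j m)
    (\sum_(k < n) 'D_(edir k) (vz i) z * H k j m z).
  move=> Iz; rewrite dirE.
  have [d1 d2] := derive_bracket I (1, 0) edir Fz vz oI C2F C2v transportD z i j m Iz.
  exact: DeriveDef.
suff phib0 : phib (t0, x0) = 0.
  have Iz0 : I (t0, x0) by [].
  rewrite bracketE -/H HE//; apply/eqP; rewrite -sqrf_eq0 expr2 eq_le -expr2 sqr_ge0 andbT.
  rewrite -phib0 /phib expr2.
  have pos i j m : 0 <= Hb i j m (t0, x0) * Hb i j m (t0, x0) by rewrite -expr2 sqr_ge0.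
  rewrite (bigD1 i0)//= (bigD1 j0)//= (bigD1 m0)//= -!addrA lerDl.
  by rewrite !addr_ge0//; do ?[apply: sumr_ge0 => ? _].
have gradM z k i : I z -> z.1 <= t0 -> `|'D_(edir k) (vz i) z| <= M.
  case: z => t x [/= tp tT Ax] tt0.
  have tt : 0 <= t <= t0 by rewrite ltW.
  apply: le_trans (bM t x tt Ax).2.
  have := ler_mx_entry (grad_vec (v t) x) i k.
  by rewrite mxE (partial_derive (fun t x => v t x 0 i)).
have M0 : 0 <= M.
  have tt : 0 <= t0 <= t0 by rewrite t00 lexx.
  exact: le_trans (normr_ge0 _) (bM t0 x0 tt Ax0).1.
apply: (transport_max_principle A T v M (2 * n%:R * M) t0 phi) => //.
- by move=> k; apply: (cv k).1.
- by move=> t x tt Ax; apply: (bM t x tt Ax).1.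
- apply: Ck1_sum => i; apply: Ck1_sum => j; apply: Ck1_sum => m.
  suff CH : Ck_extends 1 I B (H i j m) by apply: Ck1M.
  apply: Ck1_sum => l.
  have CF i' j' : Ck_extends 1 I B (Fz i' j') := Ck_extendsW _ _ _ _ (cF i' j').2.
  have CDF i' j' : Ck_extends 1 I B ('D_(edir l) (Fz i' j')) := ((cF i' j').2.2 _).2.
  by apply: Ck1B; apply: Ck1M.
- apply: within_sum => i; apply: within_sum => j; apply: within_sum => m.
  suff CH : {within B, continuous (Hb i j m)} by apply: withinM.
  apply: within_sum => l.
  by apply: withinB; apply: withinM; by [apply: (cF _ _).1|apply: cG].
- move=> z; apply: sumr_ge0 => i _; apply: sumr_ge0 => j _; apply: sumr_ge0 => m _.
  by rewrite -expr2 sqr_ge0.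
- by rewrite !mulr_ge0.
- move=> z Iz zt0.
  have Dphi := is_derive_fct_sum _ _ _ _ z (1, v z.1 z.2) (fun i =>
    is_derive_fct_sum _ _ _ _ z (1, v z.1 z.2) (fun j =>
    is_derive_fct_sum _ _ _ _ z (1, v z.1 z.2) (fun m =>
      is_derive_sqr _ _ _ _ _ (DH z i j m Iz)))).
  rewrite (@derive_val _ _ _ _ _ _ _ Dphi).
  apply: (sum3_weighted_le M (fun k i => 'D_(edir k) (vz i) z) (fun i j m => H i j m z)).
  by move=> k i; apply: gradM.
- move=> x Ax; suff Hb0 i j m : Hb i j m (0, x) = 0.
    by rewrite /phib big1// => i _; rewrite big1// => j _; rewrite big1// => m _;
       rewrite Hb0 mulr0.
  have G0 l i' j' : 'D_(edir l) (Fz i' j') (0, x) = G (l, i', j') (0, x).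
    apply: (initial_derive A T) => //.
    + exact: (cF i' j').1.
    + by move=> z Iz; apply: ((cF i' j').2.2 _).1.
    + by move=> z Iz; apply: GE.
  apply: etrans (init x i j m Ax); rewrite bracketE.
  by apply: eq_bigr => l _; rewrite -!G0.
Qed.

Lemma open_region (D : domain R n) : admissible D -> open (region D).
Proof. by case: D => [_|_|A [_ ]//]; exact: openT. Qed.

End Propagation.

Theorem lemma2p3 (R : realType) (n : nat) (n23 : n = 2%N \/ n = 3%N)
  (D : domain R n) (D_adm : admissible D) (mu : R) (mu_gt0 : 0 < mu)
  (W : 'M[R]_n -> R) (W_smooth : smooth W)
  (T : \bar R) (T_gt0 : (0 < T)%E)
  (v : R -> 'rV[R]_n -> 'rV[R]_n) (F : R -> 'rV[R]_n -> 'M[R]_n)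
  (p : R -> 'rV[R]_n -> R)
  (sol : smooth_solution mu W D T v F p)
  (v0 : 'rV[R]_n -> 'rV[R]_n) (E0 : 'rV[R]_n -> 'M[R]_n)
  (init_v : forall x, region D x -> v 0 x = v0 x)
  (init_F : forall x, region D x -> F 0 x = 1%:M + E0 x)
  (bc : boundary_conditions D T v F)
  (E : R -> 'rV[R]_n -> 'M[R]_n)
  (E_def : forall t x, E t x = F t x - 1%:M)
  (E0_compat : forall x, region D x -> forall i j m : 'I_n,
     partial m (fun y => E0 y i j) x - partial j (fun y => E0 y i m) x
     = \sum_(l < n) E0 x l j * partial l (fun y => E0 y i m) x
       - \sum_(l < n) E0 x l m * partial l (fun y => E0 y i j) x) :
  forall t x, 0 <= t -> (t%:E < T)%E -> region D x -> forall i j m : 'I_n,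
    partial m (fun y => E t y i j) x - partial j (fun y => E t y i m) x
    = \sum_(l < n) E t x l j * partial l (fun y => E t y i m) x
      - \sum_(l < n) E t x l m * partial l (fun y => E t y i j) x.
Proof.
move=> t x t0 tT Dx i j m.
have oD := open_region _ D_adm.
have partialE s y l a b : partial l (fun y => E s y a b) y = partial l (fun y => F s y a b) y.
  rewrite -[RHS](partial_subr_cst _ ((1%:M : 'M[R]_n) a b)); congr (partial l _ y).
  by apply/funext => y'; rewrite E_def !mxE.
rewrite !partialE.
under eq_bigr do rewrite partialE.
under [X in _ = _ - X]eq_bigr do rewrite partialE.
apply/(bracket_compat _ _ (fun l i j => partial l (fun y => F t y i j) x) i j m (E_def t x)).
apply: (column_bracket_transported (region D) T v F) => //.
- exact: sol_v_C2 sol.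
- exact: sol_F_C2 sol.
- exact: sol_bounded sol.
- move: bc; case: (D) => [_|_|A bcA] s y s0 sT cy nAy /=; try by case: nAy.
  by apply: (bcA s y s0 sT _).1; split=> // /interior_subset.
- exact: sol_transport sol.
move=> y a b c Dy.
have E0E : forall z, region D z -> E0 z = F 0 z - 1%:M.
  by move=> z Dz; rewrite init_F// addrC addKr.
have partial0 l a' b' : partial l (fun z => E0 z a' b') y = partial l (fun z => F 0 z a' b') y.
  rewrite -[RHS](partial_subr_cst _ ((1%:M : 'M[R]_n) a' b')).
  by apply: (derive_eq_on _ _ _ _ _ oD Dy) => z Dz; rewrite E0E// !mxE.
apply/(bracket_compat _ _ (fun l i j => partial l (fun z => F 0 z i j) y) a b c (E0E y Dy)).
have := E0_compat y Dy a b c; rewrite !partial0.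
under eq_bigr do rewrite partial0.
by under [X in _ = _ - X]eq_bigr do rewrite partial0.
Qed.
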